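(* Let $p(x,y)$ be a real polynomial with $p(0,0)=0$, $\nabla p(0,0)=(0,0)$, $\dim \operatorname{Co}N_p=2$, and such that for every $A\in\mathbb{N}^2$ the main $A$-quasi-homogeneous form of $p$ is nonnegative on $\mathbb{R}^2$ (in particular, for every corner point $(\alpha,\beta)$ of $\operatorname{Co}N_p$ that is Pareto-minimal in $N_p$, the coefficient of $x^\alpha y^\beta$ in $p$ is positive and $\alpha,\beta$ are even). Then: (i) if $\mathcal{A}_p=\emptyset$, then $(0,0)$ is a point of local minimum of $p$; (ii) if there exists $A\in\mathcal{A}_p$ for which condition $(C1)_A$ holds, then $(0,0)$ is not a point of local minimum of $p$; (iii) if $\mathcal{A}_p\neq\emptyset$ and for every $A\in\mathcal{A}_p$ condition $(C1)_A$ fails and condition $(C2)_A$ holds, then $(0,0)$ is a point of local minimum of $p$.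
   Context: $\mathbb{N}=\{1,2,\dots\}$; $\mathbb{N}_0^2$ is the set of $(A_1,A_2)\in\mathbb{N}^2$ with $\gcd(A_1,A_2)=1$. For a real polynomial $p(x,y)=\sum c_{\alpha\beta}x^\alpha y^\beta$, its support is $N_p=\{(\alpha,\beta)\in(\mathbb{N}\cup\{0\})^2: c_{\alpha\beta}\neq 0\}$ and $\operatorname{Co}N_p$ is its convex hull. For $A\in\mathbb{N}^2$, the main $A$-quasi-homogeneous form of $p$ is the sum of the terms of $p$ whose exponent vectors $k$ minimize $\langle A,k\rangle$ over $N_p$. For $A\in\mathbb{N}_0^2$, let $B_1^A<\dots<B_{r_A}^A$ be the distinct values of $\langle A,k\rangle$, $k\in N_p$, and let $\varphi_i^A$ be the sum of the terms of $p$ with $\langle A,k\rangle=B_i^A$; so $p=\varphi_1^A+\dots+\varphi_{r_A}^A$ and $\varphi_1^A$ is the main $A$-quasi-homogeneous form. If $\varphi=\sum_{i=1}^s a_ix^{\alpha_i}y^{\beta_i}$ ($a_i\neq0$, $\alpha_1>\dots>\alpha_s$) is one of these forms, its characteristic polynomial is $g(u)=\sum_i a_iu^{(\alpha_1-\alpha_i)/A_2}$ (the exponents are nonnegative integers). Let $g_1^A$ be the characteristic polynomial of $\varphi_1^A$. $\mathcal{A}_p$ is the set of $A\in\mathbb{N}_0^2$ such that $\varphi_1^A$ has at least three terms, $g_1^A(u)\ge0$ for all real $u$, and $g_1^A$ has at least one real root. For a function $\varphi$, $H_\varphi=\{(x,y)\in\mathbb{R}^2:\varphi(x,y)=0\}$.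 Condition $(C1)_A$: there is $(x_0,y_0)\in H_{\varphi_1^A}$ with $\varphi_2^A(x_0,y_0)<0$. Condition $(C2)_A$: for all $(x,y)\in H_{\varphi_1^A}$ with $x\neq0$, $y\neq0$ one has $\varphi_2^A(x,y)>0$. Local minimum at $(0,0)$ means $p(x,y)\ge p(0,0)$ in a neighborhood of $(0,0)$. *)

(* Defs.v *)
From HB Require Import structures.
From mathcomp Require Import all_boot all_order all_algebra.
From mathcomp Require Import reals.
Set Implicit Arguments. Unset Strict Implicit. Unset Printing Implicit Defensive.
Import Order.TTheory GRing.Theory Num.Theory.
Local Open Scope ring_scope.

(* A real bivariate polynomial p(x,y) = sum c i j x^i y^j is represented by a
   bound n and a coefficient function c : nat -> nat -> R vanishing outside
   [0,n]x[0,n] (this hypothesis is stated in the theorem). *)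
Section Defs.
Variable R : realType.
Implicit Types (c f : nat -> nat -> R) (A k : nat * nat).

Definition peval (n : nat) c (x y : R) : R :=
  \sum_(i < n.+1) \sum_(j < n.+1) c i j * x ^+ i * y ^+ j.

Definition dx c : nat -> nat -> R := fun i j => c i.+1 j *+ i.+1.
Definition dy c : nat -> nat -> R := fun i j => c i j.+1 *+ j.+1.

Definition supp (n : nat) c : seq (nat * nat) :=
  [seq k <- [seq (i, j) | i <- iota 0 n.+1, j <- iota 0 n.+1] | c k.1 k.2 != 0].

Definition dimCo2 (n : nat) c : Prop :=
  exists k1 k2 k3, [/\ k1 \in supp n c, k2 \in supp n c, k3 \in supp n c &
    ((k2.1%:Z - k1.1%:Z) * (k3.2%:Z - k1.2%:Z)
       - (k2.2%:Z - k1.2%:Z) * (k3.1%:Z - k1.1%:Z) != 0)].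

Definition weight A k : nat := (A.1 * k.1 + A.2 * k.2)%N.

Definition levels (n : nat) c A : seq nat :=
  sort leq (undup (map (weight A) (supp n c))).

(* phi n c A l = phi_{l+1}^A : the sum of the terms of p of weight B_{l+1}
   (so phi n c A 0 is the main A-quasi-homogeneous form; if l >= r_A the
   form is 0, since c 0 0 = 0 and the default weight is 0) *)
Definition phi (n : nat) c A (l : nat) : nat -> nat -> R :=
  fun i j => if weight A (i, j) == nth 0%N (levels n c A) l then c i j else 0.

Definition nterms (n : nat) f : nat :=
  \sum_(i < n.+1) \sum_(j < n.+1) nat_of_bool (f i j != 0%R).

Definition amax (n : nat) f : nat :=
  \max_(i < n.+1) \max_(j < n.+1) (if f i j != 0%R then (i : nat) else 0%N).

Definition charpoly (n : nat) A f : {poly R} :=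
  \sum_(i < n.+1) \sum_(j < n.+1) f i j *: 'X^((amax n f - i) %/ A.2).

Definition inAp (n : nat) c A : Prop :=
  [/\ (0 < A.1)%N, (0 < A.2)%N & coprime A.1 A.2] /\
  [/\ (3 <= nterms n (phi n c A 0))%N,
      (forall u : R, 0 <= (charpoly n A (phi n c A 0)).[u]) &
      (exists u : R, root (charpoly n A (phi n c A 0)) u)].

Definition C1 (n : nat) c A : Prop :=
  exists x0 y0 : R, peval n (phi n c A 0) x0 y0 = 0 /\
                    peval n (phi n c A 1) x0 y0 < 0.
Definition C2 (n : nat) c A : Prop :=
  forall x y : R, x != 0 -> y != 0 -> peval n (phi n c A 0) x y = 0 ->
                  0 < peval n (phi n c A 1) x y.

Definition locmin (n : nat) c : Prop :=
  exists2 e : R, 0 < e & forall x y : R, `|x| < e -> `|y| < e ->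
    peval n c 0 0 <= peval n c x y.
End Defs.

(* Main.v *)
(* If phi_1^A vanishes at (x0, y0) and phi_2^A is negative there, p is negative
   along the curve (t^A1 x0, t^A2 y0) for small t > 0.
   For the converse, fix the signs of x and y and put a = |x|, b = |y|. For a
   large constant K there are two regimes near the origin. If
   1/K <= b^A1 / a^A2 <= K for the normal A of a segment joining two points of
   the support, then (a, b) = (t^A1, t^A2 Y) with Y in the compact interval
   [1/K, K]; as phi_1^A >= 0, and phi_2^A > 0 at the zeros of phi_1^A,
   compactness makes t^B1 phi_1^A + t^B2 phi_2^A beat the terms of higher weight.
   Otherwise any two monomials of p differ by a factor larger than K, so one of
   them dominates the sum of all others; taking logarithms and rounding, it is
   the main form of p for an integer weight, hence it is nonnegative.
   A zero of phi_1^A off the axes forces A to be in A_p: such a nonnegative form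
   has at least three terms (rescale x by 2 and 1/2), and its characteristic
   polynomial is nonnegative because the vertex of largest abscissa is a main
   form for a perturbed weight. *)
Require Import Defs.
From HB Require Import structures.
From mathcomp Require Import all_boot all_order all_algebra.
From mathcomp Require Import reals.
From mathcomp Require Import topology normedtype derive sequences exp.
From mathcomp Require Import zify ring lra.
Set Implicit Arguments. Unset Strict Implicit. Unset Printing Implicit Defensive.
Import Order.TTheory GRing.Theory Num.Theory.
Import numFieldNormedType.Exports.
Local Open Scope ring_scope.

(** * Elementary estimates and one-variable polynomials over the reals *)

Lemma uniform_radius (R : realFieldType) (T : eqType) (s : seq T)
    (P : T -> R -> Prop) :
  (forall z d e, d <= e -> P z e -> P z d) ->
  (forall z, z \in s -> exists2 e, 0 < e & P z e) ->
  exists2 e, 0 < e & forall z, z \in s -> P z e.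
Proof.
move=> Pmono; elim: s => [_|z s IH Ps]; first by exists 1.
have [d d0 Pd] := Ps z (mem_head _ _).
have [e e0 Pe] : exists2 e, 0 < e & forall y, y \in s -> P y e.
  by apply: IH => y ys; apply: Ps; rewrite inE ys orbT.
exists (Num.min d e) => [|y]; first by rewrite lt_min d0.
rewrite inE => /predU1P[->|ys].
  by apply: Pmono Pd; rewrite ge_min lexx.
by apply: Pmono (Pe y ys); rewrite ge_min lexx orbT.
Qed.

Lemma small_scale (R : realFieldType) (M m : R) : 0 <= M -> 0 < m ->
  exists t : R, [/\ 0 < t, t <= 1 & t * M < m].
Proof.
move=> M0 m0; have Mm0 : 0 < M + m by rewrite ltr_wpDl.
exists (m / (M + m)); split; first by rewrite divr_gt0.
  by rewrite ler_pdivrMr // mul1r lerDr.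
by rewrite mulrAC ltr_pdivrMr // ltr_pM2l // ltrDl.
Qed.

Lemma nth_root_exists (R : realType) (m : nat) (a : R) : (0 < m)%N -> 0 < a ->
  exists2 t, 0 < t & t ^+ m = a.
Proof.
move=> m0 a0; exists (expR (ln a / m%:R)); first exact: expR_gt0.
by rewrite -expRM_natr divfK ?lnK // pnatr_eq0 -lt0n.
Qed.

(** The continuous function [F + |G| + G] is positive on the segment, hence has a positive minimum
    there; where [F] is small, [|G| + G], twice the positive part of [G], must be large. *)
Lemma poly_segment_gap (R : realType) (F G : {poly R}) (a b : R) : a <= b ->
  (forall y, a <= y <= b -> 0 <= F.[y]) ->
  (forall y, a <= y <= b -> F.[y] = 0 -> 0 < G.[y]) ->
  exists2 eta, 0 < eta &
    forall y, a <= y <= b -> eta <= F.[y] \/ eta <= G.[y].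
Proof.
move=> ab F0 G0; pose H y := F.[y] + (`|G.[y]| + G.[y]).
have Hc : continuous H.
  move=> y; have cF := @continuous_horner R F y.
  have cG := @continuous_horner R G y.
  apply: cvgD => //; apply: cvgD => //.
  exact: (cvg_norm cG).
have [y0 y0ab ymin] := EVT_min ab (continuous_subspaceT Hc).
rewrite in_itv /= in y0ab.
have GG y : 0 <= `|G.[y]| + G.[y] by have := ler_norm (- G.[y]); rewrite normrN; lra.
have H0 : 0 < H y0.
  rewrite /H; have := F0 _ y0ab; rewrite le_eqVlt => /predU1P[e|Fp].
    by have Gp := G0 _ y0ab (esym e); rewrite -e add0r ltr_wpDl.
  by have := GG y0; lra.
exists (H y0 / 4%:R) => [|y yab]; first by rewrite divr_gt0.
have := ymin y; rewrite in_itv /= => /(_ yab); rewrite {2}/H => Hy.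
have [|Fl] := lerP (H y0 / 4) F.[y]; first by left.
right; have := GG y; case: (lerP 0 G.[y]) => g.
  by rewrite (ger0_norm g) in Hy *; lra.
by rewrite (ltr0_norm g) in Hy *; lra.
Qed.

(** A negative value at [a] would persist nearby. This extends inequalities known for nonzero
    arguments to the argument 0. *)
Lemma poly_ge0_limit (R : realType) (q : {poly R}) (a e : R) : 0 < e ->
  (forall y, y != a -> `|y - a| < e -> 0 <= q.[y]) -> 0 <= q.[a].
Proof.
move=> e0 qpos; rewrite leNgt; apply/negP => qneg.
have := @continuous_horner R q a => /cvgrPdist_lt /(_ (- q.[a])).
rewrite oppr_gt0 => /(_ qneg) /nbhs_ballP[d /= d0 dball].
pose m := Num.min d e; have m0 : 0 < m by rewrite lt_min d0 e0.
have mh : `|m / 2| = m / 2 by rewrite ger0_norm // divr_ge0 // ltW.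
have md : m / 2 < m by rewrite gtr_pMr ?invf_lt1 ?ltr1n.
have /dball : ball a d (a + m / 2).
  rewrite /ball /= opprD addrA subrr sub0r normrN mh.
  by apply: lt_le_trans md _; rewrite ge_min lexx.
have : 0 <= q.[a + m / 2].
  apply: qpos; first by rewrite -subr_eq0 addrAC subrr add0r gt_eqF // divr_gt0.
  rewrite addrAC subrr add0r mh.
  by apply: lt_le_trans md _; rewrite ge_min lexx orbT.
move=> qp; rewrite ltr_norml => /andP[+ _]; lra.
Qed.

(** A general relation [r] serves both for the point of least weight and for the monomial of largest
    value. *)
Lemma seq_extremum (T : eqType) (U : Type) (r : rel U) (f : T -> U) (s : seq T) :
  total r -> transitive r -> s != [::] ->
  exists2 v, v \in s & forall k, k \in s -> r (f v) (f k).
Proof.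
move=> r_tot r_trans; have r_refl u : r u u by have := r_tot u u; rewrite orbb.
elim: s => // k s IH _; have [->|/IH[v vs vext]] := eqVneq s [::].
  by exists k => [|l]; rewrite ?mem_head // inE => /eqP ->.
have [kv|vk] := orP (r_tot (f k) (f v)).
  exists k => [|l]; rewrite ?mem_head // inE => /predU1P[->//|/vext].
  exact: r_trans kv.
by exists v => [|l]; rewrite inE ?vs ?orbT // => /predU1P[->|/vext].
Qed.

(** * Supports, weight levels and expansion along quasi-homogeneous curves *)

Section Support.
Variables (R : realType) (n : nat).
Implicit Types (c f : nat -> nat -> R) (A k : nat * nat).

Lemma mem_supp c k :
  (k \in supp n c) = [&& (k.1 <= n)%N, (k.2 <= n)%N & c k.1 k.2 != 0].
Proof.
rewrite mem_filter andbC andbA; congr (_ && _).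
apply/allpairsP/andP => [[[i j] [+ + ->]]|[k1 k2]].
  by rewrite !mem_iota !ltnS.
by exists k; split; [rewrite mem_iota| rewrite mem_iota|case: k {k1 k2}].
Qed.

Lemma peval0 c : peval n c 0 0 = c 0%N 0%N.
Proof.
rewrite /peval big_ord_recl [X in _ + X]big1 => [|i _]; last first.
  by rewrite big1 // => j _; rewrite expr0n /= mulr0 mul0r.
rewrite addr0 big_ord_recl [X in _ + X]big1 => [|j _]; last by rewrite !expr0n /= mulr0.
by rewrite !expr0n /= !mulr1 !addr0.
Qed.

Lemma peval_bound f (b : nat -> nat -> R) (x y : R) :
  (forall i j : nat, (i <= n)%N -> (j <= n)%N ->
     `|f i j * x ^+ i * y ^+ j| <= b i j) ->
  `|peval n f x y| <= \sum_(i < n.+1) \sum_(j < n.+1) b i j.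
Proof.
move=> fb; apply: le_trans (ler_norm_sum _ _ _) _; apply: ler_sum => i _.
apply: le_trans (ler_norm_sum _ _ _) _; apply: ler_sum => j _.
by apply: fb; rewrite -ltnS.
Qed.

Lemma pevalD f g x y :
  peval n (fun i j => f i j + g i j) x y = peval n f x y + peval n g x y.
Proof.
rewrite /peval -big_split; apply: eq_bigr => i _ /=.
by rewrite -big_split; apply: eq_bigr => j _ /=; rewrite !mulrDl.
Qed.

Lemma peval_monomial k (a x y : R) : (k.1 <= n)%N -> (k.2 <= n)%N ->
  peval n (fun i j => if (i, j) == k then a else 0) x y =
  a * x ^+ k.1 * y ^+ k.2.
Proof.
case: k => i j /=; rewrite -(ltnS i) -(ltnS j) => i_n j_n.
rewrite /peval (bigD1 (Ordinal i_n)) //= (bigD1 (Ordinal j_n)) //= eqxx.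
rewrite big1 ?addr0 => [|k /negPf kj]; last first.
  by rewrite xpair_eqE eqxx /= -[j]/(val (Ordinal j_n)) val_eqE kj !mul0r.
rewrite big1 ?addr0 // => k /negPf ki; rewrite big1 // => l _.
by rewrite xpair_eqE -[i]/(val (Ordinal i_n)) val_eqE ki !mul0r.
Qed.

Lemma eq_peval f g x y :
  (forall i j : nat, (i <= n)%N -> (j <= n)%N -> f i j = g i j) ->
  peval n f x y = peval n g x y.
Proof.
move=> fg; apply: eq_bigr => i _; apply: eq_bigr => j _.
by rewrite fg // -ltnS.
Qed.

Lemma peval_poly f (x tau : R) : exists q : {poly R},
  forall y, q.[y] = peval n f x (tau * y).
Proof.
exists (\sum_(i < n.+1) \sum_(j < n.+1) (f i j * x ^+ i * tau ^+ j) *: 'X^j).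
move=> y; rewrite horner_sum; apply: eq_bigr => i _.
rewrite horner_sum; apply: eq_bigr => j _.
by rewrite hornerZ hornerXn exprMn mulrA.
Qed.

Lemma peval_poly_l f (y : R) : exists q : {poly R},
  forall x, q.[x] = peval n f x y.
Proof.
exists (\sum_(i < n.+1) \sum_(j < n.+1) (f i j * y ^+ j) *: 'X^i).
move=> x; rewrite horner_sum; apply: eq_bigr => i _.
rewrite horner_sum; apply: eq_bigr => j _.
by rewrite hornerZ hornerXn mulrAC.
Qed.

Lemma mem_levels c A w :
  reflect (exists2 k, k \in supp n c & w = weight A k) (w \in levels n c A).
Proof. by rewrite mem_sort mem_undup; apply: mapP. Qed.

Lemma levels_sorted c A : sorted ltn (levels n c A).
Proof.
rewrite ltn_sorted_uniq_leq sort_uniq undup_uniq.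
by rewrite sort_sorted //; exact: leq_total.
Qed.

Lemma main_form_minimal c A v : v \in supp n c ->
  (forall k, k \in supp n c -> (weight A v <= weight A k)%N) ->
  phi n c A 0 = fun i j => if weight A (i, j) == weight A v then c i j else 0.
Proof.
move=> vs vmin; rewrite /phi.
suff -> : nth 0%N (levels n c A) 0 = weight A v by [].
have := levels_sorted c A; have := mem_levels c A.
have : weight A v \in levels n c A by apply/mem_levels; exists v.
case: levels => //= w s; rewrite inE => /predU1P[//|vin] memw.
rewrite path_sortedE; last exact: ltn_trans.
move=> /andP[/allP /(_ _ vin) wv _].
have /memw[k ks wk] : w \in w :: s by rewrite mem_head.
by have := vmin k ks; lia.
Qed.

(* When there is a single level, [phi n c A 1] is the zero form (whence the
   hypothesis on [c 0 0]) and [B2] is [B1.+1]. *)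
Lemma two_levels c A : c 0%N 0%N = 0 -> (0 < A.1)%N -> (0 < A.2)%N ->
  supp n c != [::] ->
  exists B1 B2, [/\ (B1 < B2)%N,
    forall i j, (i <= n)%N -> (j <= n)%N ->
      phi n c A 0 i j = if weight A (i, j) == B1 then c i j else 0,
    forall i j, (i <= n)%N -> (j <= n)%N ->
      phi n c A 1 i j = if weight A (i, j) == B2 then c i j else 0 &
    forall k, k \in supp n c ->
      [\/ weight A k = B1, weight A k = B2 | (B2 < weight A k)%N]].
Proof.
move=> c00 A1 A2 s0; have := levels_sorted c A; have memw := mem_levels c A.
rewrite /phi; case: levels memw => [|B1 [|B2 s]] memw /= sorted_s.
- case E: (supp n c) s0 => [//|k s] _.
  have : weight A k \in [::] by apply/memw; exists k; rewrite ?E ?mem_head.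
  by rewrite in_nil.
- have wB1 k : k \in supp n c -> weight A k = B1.
    move=> ks; have : weight A k \in [:: B1] by apply/memw; exists k.
    by rewrite inE => /eqP.
  exists B1, B1.+1; split=> //.
  (* The missing second level is read as the default weight 0, which only the exponent [(0, 0)]
     has. *)
  + move=> i j i_n j_n; case: eqP => [w0|_].
      have -> : i = 0%N by move: w0; rewrite /weight /=; nia.
      have -> : j = 0%N by move: w0; rewrite /weight /=; nia.
      by rewrite c00; case: ifP.
    case: eqP => // wB; apply/esym/eqP/negPn/negP => cij.
    have /wB1 : (i, j) \in supp n c by rewrite mem_supp /= i_n j_n.
    by rewrite wB; lia.
  + by move=> k /wB1; constructor 1.
- case/andP: sorted_s => B12; rewrite path_sortedE; last exact: ltn_trans.
  move=> /andP[/allP B2s _].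
  exists B1, B2; split=> //.
  move=> k ks; have : weight A k \in [:: B1, B2 & s] by apply/memw; exists k.
  by rewrite !inE => /or3P[/eqP w|/eqP w|/B2s w]; [constructor 1|constructor 2|constructor 3].
Qed.

(** A monomial of weight [w] picks up the factor [t ^+ w]. The levels [B1] and [B2] cancel; all
    other weights are at least [B2.+1], and [t] is at most 1. *)
Lemma quasi_homogeneous_expansion c A B1 B2 (t X Y : R) :
  (B1 < B2)%N ->
  (forall i j, (i <= n)%N -> (j <= n)%N ->
    phi n c A 0 i j = if weight A (i, j) == B1 then c i j else 0) ->
  (forall i j, (i <= n)%N -> (j <= n)%N ->
    phi n c A 1 i j = if weight A (i, j) == B2 then c i j else 0) ->
  (forall k, k \in supp n c ->
    [\/ weight A k = B1, weight A k = B2 | (B2 < weight A k)%N]) ->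
  0 <= t <= 1 ->
  `|peval n c (t ^+ A.1 * X) (t ^+ A.2 * Y)
    - (t ^+ B1 * peval n (phi n c A 0) X Y
       + t ^+ B2 * peval n (phi n c A 1) X Y)|
  <= t ^+ B2.+1 *
     \sum_(i < n.+1) \sum_(j < n.+1) `|c i j| * `|X| ^+ i * `|Y| ^+ j.
Proof.
move=> B12 p0 p1 lev /andP[t0 t1].
rewrite /peval !mulr_sumr -big_split /= -sumrB.
apply: le_trans (ler_norm_sum _ _ _) _; apply: ler_sum => i _.
rewrite !mulr_sumr -big_split /= -sumrB.
apply: le_trans (ler_norm_sum _ _ _) _; apply: ler_sum => j _.
have [i_n j_n] : (i <= n)%N /\ (j <= n)%N by rewrite -ltnS -(ltnS j) !ltn_ord.
rewrite p0 // p1 //.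
have -> : c i j * (t ^+ A.1 * X) ^+ i * (t ^+ A.2 * Y) ^+ j
    = t ^+ weight A (val i, val j) * (c i j * X ^+ i * Y ^+ j).
  by rewrite /weight /= exprD !exprM !exprMn; ring.
have rhs0 : 0 <= t ^+ B2.+1 * (`|c i j| * `|X| ^+ i * `|Y| ^+ j).
  by rewrite !mulr_ge0 ?exprn_ge0.
have [->|cij] := eqVneq (c i j) 0.
  by rewrite !if_same !(mul0r, mulr0, normr0) addr0 subrr normr0.
have /lev : (val i, val j) \in supp n c by rewrite mem_supp /= i_n j_n.
case=> w.
- by rewrite w eqxx ltn_eqF // !mul0r mulr0 addr0 subrr normr0.
- by rewrite w eqxx gtn_eqF // !mul0r mulr0 add0r subrr normr0.
rewrite !gtn_eqF ?(ltn_trans B12) // !mul0r !mulr0 addr0 subr0.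
rewrite !normrM !normrX (ger0_norm t0) ler_wpM2r ?mulr_ge0 ?exprn_ge0 //.
by rewrite ler_wiXn2l.
Qed.

End Support.

(** * Nonnegative main forms and their characteristic polynomials *)

Section Characteristic.
Variables (R : realType) (n : nat) (c : nat -> nat -> R).
Hypothesis hnn : forall A : nat * nat, (0 < A.1)%N -> (0 < A.2)%N ->
  forall x y : R, 0 <= peval n (phi n c A 0) x y.

(** With [v] as only minimiser, the main form for [A] is the single monomial at [v]. *)
Lemma vertex_monomial_ge0 (A v : nat * nat) : (0 < A.1)%N -> (0 < A.2)%N ->
  v \in supp n c ->
  (forall k, k \in supp n c -> k != v -> (weight A v < weight A k)%N) ->
  forall x y : R, 0 <= c v.1 v.2 * x ^+ v.1 * y ^+ v.2.
Proof.
move=> A1 A2 vs vmin x y; have := hnn A1 A2 x y.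
have := vs; rewrite mem_supp => /and3P[v1 v2 _].
rewrite (@main_form_minimal _ _ _ _ v) // => [|k ks]; last first.
  by have [->|/vmin] := eqVneq k v; [|move=> /(_ ks)/ltnW].
rewrite -(peval_monomial _ _ _ v1 v2); congr (_ <= _); apply: eq_peval => i j i_n j_n.
have [<-|ij_v] := eqVneq (i, j) v; first by rewrite !eqxx.
case: eqP => // wij; apply/eqP/negPn/negP => cij.
have /vmin/(_ ij_v) : (i, j) \in supp n c by rewrite mem_supp /= i_n j_n.
by rewrite wij ltnn.
Qed.

Variable A : nat * nat.
Hypotheses (A1 : (0 < A.1)%N) (A2 : (0 < A.2)%N).

Let f := phi n c A 0.

Lemma main_form_support : supp n c != [::] -> exists2 B,
  (exists2 v, v \in supp n c & weight A v = B) &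
  (forall i j, f i j = if weight A (i, j) == B then c i j else 0) /\
  (forall k, k \in supp n c -> (B <= weight A k)%N).
Proof.
move=> s0.
have [v vs vmin] := seq_extremum (weight A) leq_total leq_trans s0.
by exists (weight A v); [exists v | rewrite /f (main_form_minimal vs vmin)].
Qed.

(* The vertex of largest abscissa on the face cut out by [A] is the only
   minimiser of the weight [(N * A.1, N * A.2 + 1)] for [N > n]. *)
Lemma main_form_top : supp n c != [::] -> exists a b : nat,
  [/\ (a <= n)%N /\ (b <= n)%N, f a b != 0,
      forall i j, (i <= n)%N -> (j <= n)%N -> f i j != 0 ->
        (i <= a)%N /\ weight A (i, j) = weight A (a, b),
      amax n f = a &
      forall x y : R, x != 0 -> y != 0 -> 0 < x ^+ a * y ^+ b].
Proof.
move=> /main_form_support[B [v vs vB] [fE Bmin]].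
have [v1 v2 cv] := and3P (etrans (esym (mem_supp n c v)) vs).
pose P a := [exists b : 'I_n.+1, f a b != 0].
have Pv : exists a, P a && (a <= n)%N.
  exists v.1; rewrite v1 andbT; apply/existsP; rewrite -ltnS in v2.
  by exists (Ordinal v2); rewrite fE -surjective_pairing vB eqxx.
have Pn a : P a && (a <= n)%N -> (a <= n)%N by case/andP.
case: (ex_maxnP Pv Pn) => a /andP[/existsP[b fab] an] amaxP.
have bn : (b <= n)%N by rewrite -ltnS.
have wf i j : f i j != 0 -> weight A (i, j) = B /\ c i j != 0.
  by rewrite fE; case: ifP => [/eqP|_]; rewrite ?eqxx.
have [wab cab] := wf _ _ fab.
have top i j : (i <= n)%N -> (j <= n)%N -> f i j != 0 -> (i <= a)%N.
  move=> i_n j_n fij; apply: amaxP; rewrite i_n andbT; apply/existsP.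
  by exists (inord j); rewrite inordK ?ltnS.
(* The new weight is [n.+1] times the old one plus the ordinate. Off the face the first part grows
   by at least [n.+1], more than any ordinate; on the face a smaller abscissa means a larger
   ordinate. *)
have vmin k : k \in supp n c -> k != (a, b : nat) ->
    (weight (n.+1 * A.1, (n.+1 * A.2).+1)%N (a, b : nat)
      < weight (n.+1 * A.1, (n.+1 * A.2).+1)%N k)%N.
  move=> ks kab; have := Bmin k ks; have := ks; rewrite mem_supp => /and3P[k1 k2 ck].
  rewrite leq_eqVlt => /predU1P[kB|].
    have fk : f k.1 k.2 != 0 by rewrite fE -surjective_pairing -kB eqxx.
    have ka := top _ _ k1 k2 fk.
    have : (a, b : nat) != k by rewrite eq_sym.
    case: k {ks kab ck fk} k1 k2 kB ka => i j /= i_n j_n; rewrite -wab.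
    rewrite /weight /= xpair_eqE => eqw ia nab.
    have [ia'|ia'] := eqVneq i a.
      subst i; move: nab; rewrite eqxx /=.
      have -> : j = b by nia.
      by rewrite eqxx.
    have : (b < j)%N by nia.
    by nia.
  by rewrite -wab /weight /=; nia.
have abs : (a, b : nat) \in supp n c by rewrite mem_supp /= an bn.
have N1 : (0 < n.+1 * A.1)%N by rewrite muln_gt0.
have vge0 := @vertex_monomial_ge0 (n.+1 * A.1, (n.+1 * A.2).+1)%N (a, b : nat) N1 isT abs vmin.
exists a, b; split=> //.
- by move=> i j i_n j_n fij; split; [exact: top fij | rewrite wab; case: (wf _ _ fij)].
- apply/eqP; rewrite eqn_leq; apply/andP; split.
    apply/bigmax_leqP => i _; apply/bigmax_leqP => j _; case: ifP => // fij.
    by apply: top fij; rewrite -ltnS.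
  rewrite /amax; rewrite -ltnS in an.
  apply: (bigop.bigmax_sup (Ordinal an)) => //; apply: (bigop.bigmax_sup b) => //=.
  by rewrite fab.
- move=> x y x0 y0; have := vge0 1 1; rewrite /= !expr1n !mulr1 => c_ge0.
  have c_gt0 : 0 < c a b by rewrite lt_neqAle eq_sym cab.
  have := vge0 x y; rewrite /= -mulrA pmulr_rge0 // => xy0.
  by rewrite lt_neqAle eq_sym mulf_neq0 // expf_neq0.
Qed.

(** On the face, [A.1 * (a - i) = A.2 * (j - b)], so coprimality gives [a - i = q * A.2] and
    [j - b = q * A.1]: each monomial is [x ^+ a * y ^+ b] times the [q]-th power of
    [y ^+ A.1 / x ^+ A.2]. *)
Lemma charpolyE (a b : nat) (x y : R) : (b <= n)%N ->
  coprime A.1 A.2 -> amax n f = a ->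
  (forall i j, (i <= n)%N -> (j <= n)%N -> f i j != 0 ->
        (i <= a)%N /\ weight A (i, j) = weight A (a, b)) ->
  x != 0 ->
  peval n f x y = x ^+ a * y ^+ b * (charpoly n A f).[y ^+ A.1 / x ^+ A.2].
Proof.
move=> bn cA amE fab x0.
rewrite /charpoly horner_sum mulr_sumr; apply: eq_bigr => i _.
rewrite horner_sum mulr_sumr; apply: eq_bigr => j _.
rewrite hornerZ hornerXn; have [->|fij] := eqVneq (f i j) 0.
  by rewrite !(mul0r, mulr0).
have [i_n j_n] : (i <= n)%N /\ (j <= n)%N by rewrite -ltnS -(ltnS j) !ltn_ord.
have [ia] := fab _ _ i_n j_n fij; rewrite /weight amE /= => wE.
have /dvdnP[q aq] : (A.2 %| a - i)%N.
  rewrite -(Gauss_dvdr _ (n := A.1)) 1?coprime_sym //.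
  by apply/dvdnP; exists (j - b)%N; nia.
rewrite aq mulnK //.
have jq : (j : nat) = (b + q * A.1)%N.
  have : (A.2 * j = A.2 * (b + q * A.1))%N by nia.
  by move/eqP; rewrite eqn_pmul2l // => /eqP.
have -> : a = (i + q * A.2)%N by lia.
rewrite jq !exprD expr_div_n -!exprM (mulnC A.1) (mulnC A.2).
have xq : x ^+ (q * A.2) != 0 by rewrite expf_neq0.
by field.
Qed.

(** For negative [u], coprimality makes one of the two exponents odd, and the sign is put on the
    corresponding coordinate. *)
Lemma quotient_power_surj (u : R) : coprime A.1 A.2 -> u != 0 ->
  exists x y : R, [/\ x != 0, y != 0 & y ^+ A.1 / x ^+ A.2 = u].
Proof.
move=> cA u0; have [t t0 tu] := @nth_root_exists R A.1 `|u| A1 (ltac:(by rewrite normr_gt0)).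
have tn0 : t != 0 by rewrite gt_eqF.
have [up|un] := ltrP 0 u.
  by exists 1, t; rewrite expr1n divr1 oner_neq0 tu gtr0_norm.
rewrite ler0_norm // in tu.
case oddA : (odd A.1).
  exists 1, (- t); rewrite expr1n divr1 oner_neq0 oppr_eq0; split=> //.
  by rewrite exprNn -signr_odd oddA tu expr1 mulN1r opprK.
have oddA2 : odd A.2.
  apply/negPn/negP => evA2.
  have : (2 %| gcdn A.1 A.2)%N by rewrite dvdn_gcd !dvdn2 oddA evA2.
  by rewrite (eqP cA).
exists (-1), t; rewrite oppr_eq0 oner_neq0 -signr_odd oddA2 expr1 tu; split=> //.
by rewrite invrN1 mulrN1 opprK.
Qed.

(** A single term cannot vanish off the axes. If two terms cancel at [(x, y)], their sum at
    [(s * x, y)] is a difference of powers of [s] times one of them, negative at [s = 2] or at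
    [s = 1/2]. *)
Lemma zero_off_axes_three_terms (x y : R) : supp n c != [::] ->
  x != 0 -> y != 0 -> peval n f x y = 0 -> (3 <= nterms n f)%N.
Proof.
move=> /main_form_top[a [b [[an bn] fab top _ _]]] x0 y0 fxy0.
pose S := [set z : 'I_n.+1 * 'I_n.+1 | f z.1 z.2 != 0].
pose T (z : 'I_n.+1 * 'I_n.+1) := f z.1 z.2 * x ^+ z.1 * y ^+ z.2.
have -> : nterms n f = #|S|.
  rewrite /nterms pair_big /= -sum1_card [RHS]big_mkcond /=.
  by apply: eq_bigr => z _; rewrite inE; case: (f _ _ != 0).
have scale s : peval n f (s * x) y = \sum_(z in S) s ^+ z.1 * T z.
  rewrite /peval pair_big /= [RHS]big_mkcond; apply: eq_bigr => z _ /=.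
  rewrite inE /T; have [->|_] /= := eqVneq; first by rewrite !mul0r.
  by rewrite exprMn; ring.
have sum_ge0 s : 0 <= \sum_(z in S) s ^+ z.1 * T z by rewrite -scale hnn.
have sum0 : \sum_(z in S) T z = 0.
  have := scale 1; rewrite mul1r fxy0 => e0; rewrite [RHS]e0.
  by apply: eq_bigr => z _; rewrite expr1n mul1r.
have T0 z : z \in S -> T z != 0.
  by rewrite inE => fz; rewrite !mulf_neq0 ?expf_neq0.
have S0 : (0 < #|S|)%N.
  apply/card_gt0P; rewrite -ltnS in an; rewrite -ltnS in bn.
  by exists (Ordinal an, Ordinal bn); rewrite inE.
rewrite ltnNge leq_eqVlt ltnS; apply/negP => /orP[/cards2P[z [w [zw SE]]]|S1].
  have zS : z \in S by rewrite SE !inE eqxx.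
  have wS : w \in S by rewrite SE !inE eqxx orbT.
  rewrite SE in sum0 sum_ge0.
  have sumE s : \sum_(k in [set z; w]) s ^+ k.1 * T k = (s ^+ z.1 - s ^+ w.1) * T z.
    move: sum0; rewrite !big_setU1 ?inE // !big_set1 /= => /eqP.
    by rewrite addrC addr_eq0 => /eqP ->; ring.
  (* Points on the face are determined by their abscissa, so the two powers of [s] differ. *)
  have zw1 : (z.1 : nat) != w.1.
    apply: contraNneq zw => zw1; move: zS wS; rewrite !inE => fz fw.
    have le_n (i : 'I_n.+1) : (i <= n)%N by rewrite -ltnS.
    have [_ wz] := top _ _ (le_n z.1) (le_n z.2) fz.
    have [_ ww] := top _ _ (le_n w.1) (le_n w.2) fw.
    have /eqP : (A.2 * z.2 = A.2 * w.2)%N.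
      by move: wz ww; rewrite /weight /= zw1 => <- /addnI.
    rewrite eqn_pmul2l // => /eqP zw2;
    apply/eqP; rewrite [z]surjective_pairing [w]surjective_pairing.
    by congr (_, _); apply: val_inj.
  have := sum_ge0 2; have := sum_ge0 2^-1; rewrite !sumE !exprVn.
  have := T0 z zS.
  have pow2 (m k : nat) : (m < k)%N ->
      (2 : R) ^+ m < 2 ^+ k /\ ((2 : R) ^+ k)^-1 < (2 ^+ m)^-1.
    by move=> mk; rewrite ltf_pV2 ?posrE ?exprn_gt0 // ltr_eXn2l ?ltr1n.
  by case: (ltngtP z.1 w.1) zw1 => // /pow2[p q] _; rewrite neq_lt => /orP[];
    nra.
have /cards1P[z SE] : #|S| == 1%N by rewrite eqn_leq S1.
have zS : z \in S by rewrite SE set11.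
by have /eqP := T0 z zS; apply; rewrite -sum0 SE big_set1.
Qed.

(** Off the axes the form is a positive monomial times the characteristic polynomial at
    [y ^+ A.1 / x ^+ A.2]. This quotient takes every nonzero value; the value 0 follows by
    continuity. *)
Lemma zero_off_axes_inAp (x y : R) : supp n c != [::] -> coprime A.1 A.2 ->
  x != 0 -> y != 0 -> peval n f x y = 0 -> inAp n c A.
Proof.
move=> s0 cA x0 y0 fxy0; split; first by [].
have [a [b [[an bn] fab top amE pos]]] := main_form_top s0.
split; first exact: zero_off_axes_three_terms fxy0.
  have ge0 u : u != 0 -> 0 <= (charpoly n A f).[u].
    move=> u0; have [s [t [s0' t0 <-]]] := quotient_power_surj cA u0.
    by have := hnn A1 A2 s t; rewrite -/f (@charpolyE a b) // pmulr_rge0 // pos.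
  move=> u; have [->|/ge0//] := eqVneq u 0.
  by apply: (@poly_ge0_limit _ _ _ 1) => // v /ge0.
exists (y ^+ A.1 / x ^+ A.2); apply/eqP; move/eqP: fxy0.
rewrite (@charpolyE a b) // mulf_eq0 => /orP[|/eqP //].
by rewrite gt_eqF // pos.
Qed.

End Characteristic.

(** * Sign of the polynomial in edge regions and under a dominating monomial *)

Section Positivity.
Variables (R : realType) (n : nat) (c : nat -> nat -> R).
Hypothesis hnn : forall A : nat * nat, (0 < A.1)%N -> (0 < A.2)%N ->
  forall x y : R, 0 <= peval n (phi n c A 0) x y.
Hypothesis c00 : c 0%N 0%N = 0.
Hypothesis supp0 : supp n c != [::].

(** A zero of the main form on the segment lies off the axes, so it gives [inAp n c A] and thereby
    [C2]; compactness then yields a uniform [eta]. *)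
Lemma edge_region_ge0 (A : nat * nat) (sigma tau K : R) :
  `|sigma| = 1 -> `|tau| = 1 -> 1 <= K ->
  (0 < A.1)%N -> (0 < A.2)%N -> coprime A.1 A.2 -> (inAp n c A -> C2 n c A) ->
  exists2 e, 0 < e & forall a b : R, 0 < a < e -> 0 < b ->
    a ^+ A.2 <= K * b ^+ A.1 -> b ^+ A.1 <= K * a ^+ A.2 ->
    0 <= peval n c (sigma * a) (tau * b).
Proof.
move=> sigma1 tau1 K1 A1 A2 cA hC2.
have K0 : 0 < K := lt_le_trans ltr01 K1.
have sn0 : sigma != 0 by rewrite -normr_eq0 sigma1 oner_neq0.
have tn0 : tau != 0 by rewrite -normr_eq0 tau1 oner_neq0.
have [B1 [B2 [B12 p0 p1 lev]]] := two_levels c00 A1 A2 supp0.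
have [F FE] := peval_poly n (phi n c A 0) sigma tau.
have [G GE] := peval_poly n (phi n c A 1) sigma tau.
have Kinv : K^-1 <= K by rewrite (le_trans _ K1) // invf_le1.
have [|y yK|eta eta0 gap] := @poly_segment_gap R F G K^-1 K Kinv.
- by move=> y _; rewrite FE hnn.
- rewrite FE GE => Fy0.
  have yn0 : tau * y != 0.
    rewrite mulf_neq0 // gt_eqF //; case/andP: yK => + _; apply: lt_le_trans.
    by rewrite invr_gt0.
  by apply: hC2 => //; apply: zero_off_axes_inAp Fy0.
(* [C] bounds both the second form and the coefficient of the remainder, whence the factor 2 in the
   choice of [t0]. *)
pose C := \sum_(i < n.+1) \sum_(j < n.+1) `|c i j| * K ^+ j.
have C0 : 0 <= C.
  apply: sumr_ge0 => i _; apply: sumr_ge0 => j _.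
  by rewrite mulr_ge0 // exprn_ge0 // ltW.
have [t0 [t00 t01 t0C]] := small_scale (mulr_ge0 (ler0n R 2) C0) eta0.
exists (t0 ^+ A.1) => [|a b /andP[a0 ae] b0 abK baK]; first by rewrite exprn_gt0.
have [t tp ta] := nth_root_exists A1 a0.
have tlt : t < t0 by move: ae; rewrite -ta ltr_pXn2r // nnegrE ltW.
have t1 : t <= 1 := le_trans (ltW tlt) t01.
(* With this scaling [Y ^+ A.1] is [b ^+ A.1 / a ^+ A.2], which lies in [[1/K, K]]; as [K >= 1] and
   [A.1 > 0], so does [Y]. *)
pose Y := b / t ^+ A.2.
have tA0 : 0 < t ^+ A.2 by rewrite exprn_gt0.
have Y0 : 0 < Y by rewrite divr_gt0.
have bE : b = t ^+ A.2 * Y by rewrite /Y mulrC divfK // gt_eqF.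
have aA : a ^+ A.2 = (t ^+ A.2) ^+ A.1 by rewrite -ta -!exprM mulnC.
have YA : b ^+ A.1 = a ^+ A.2 * Y ^+ A.1 by rewrite aA bE exprMn.
have aA0 : 0 < a ^+ A.2 by rewrite exprn_gt0.
have YK : K^-1 <= Y <= K.
  apply/andP; split; rewrite leNgt; apply/negP => YK.
    have : Y ^+ A.1 < K^-1.
      apply: lt_le_trans (_ : K^-1 ^+ A.1 <= _).
        by rewrite ltr_pXn2r ?nnegrE ?invr_ge0 ?ltW.
      by rewrite ler_iXnr // ?invr_ge0 ?invf_le1 // ltW.
    move=> YA'; have : K * Y ^+ A.1 < 1 by rewrite -ltr_pdivlMl // mulr1.
    by move: abK; rewrite YA mulrCA ler_pMr // => /le_lt_trans /[apply]; rewrite ltxx.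
  have : K < Y ^+ A.1.
    apply: le_lt_trans (_ : K ^+ A.1 < _); last by rewrite ltr_pXn2r ?nnegrE ?ltW.
    by rewrite ler_eXnr.
  by move: baK; rewrite YA mulrC ler_pM2r // => /le_lt_trans /[apply]; rewrite ltxx.
have := @quasi_homogeneous_expansion _ _ _ _ _ _ t sigma (tau * Y) B12 p0 p1 lev.
rewrite ltW //= t1 => /(_ isT).
rewrite -FE -GE mulrCA -bE ta [a * sigma]mulrC.
set p := peval n c _ _.
have -> : \sum_(i < n.+1) \sum_(j < n.+1) `|c i j| * `|sigma| ^+ i * `|tau * Y| ^+ j
    = \sum_(i < n.+1) \sum_(j < n.+1) `|c i j| * Y ^+ j.
  apply: eq_bigr => i _; apply: eq_bigr => j _.
  by rewrite normrM sigma1 tau1 expr1n mulr1 mul1r (gtr0_norm Y0).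
have YC : \sum_(i < n.+1) \sum_(j < n.+1) `|c i j| * Y ^+ j <= C.
  apply: ler_sum => i _; apply: ler_sum => j _; rewrite ler_wpM2l //.
  have [_ YK2] := andP YK.
  by rewrite lerXn2r ?nnegrE ?(ltW Y0) ?(ltW K0).
have GC : `|G.[Y]| <= C.
  apply: le_trans YC; rewrite GE.
  apply: (peval_bound (b := fun i j => `|c i j| * Y ^+ j)) => i j i_n j_n.
  rewrite p1 //; case: ifP => _; last first.
    by rewrite !mul0r normr0 mulr_ge0 // exprn_ge0 // ltW.
  by rewrite !normrM !normrX normrM sigma1 tau1 expr1n mulr1 mul1r (gtr0_norm Y0).
have F0 : 0 <= F.[Y] by rewrite FE hnn.
have tB1 : 0 < t ^+ B1 by rewrite exprn_gt0.
have tB2 : 0 < t ^+ B2 by rewrite exprn_gt0.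
have tB21 : t ^+ B2 <= t ^+ B1 * t.
  by rewrite -exprSr ler_wiXn2l // ltW.
move=> /le_trans /(_ (ler_wpM2l _ YC)); rewrite exprS.
have : t * (2 * C) < eta.
  by apply: le_lt_trans t0C; rewrite ler_wpM2r ?mulr_ge0 // ltW.
move=> tC /(_ (ltW (mulr_gt0 tp tB2))).
rewrite ler_norml => /andP[+ _] => pge.
move: GC; rewrite ler_norml => /andP[GC _].
have tC1 : t * C <= C by rewrite ler_piMl.
(* If [F] is at least [eta], the first term covers all losses, since [t ^+ B2 <= t ^+ B1 * t].
   Otherwise the first term is nonnegative and the second covers the remainder. *)
have [Feta|Geta] := gap _ YK.
  have h1 : t ^+ B1 * eta <= t ^+ B1 * F.[Y] by rewrite ler_pM2l.
  have h2 : t ^+ B2 * - C <= t ^+ B2 * G.[Y] by rewrite ler_pM2l.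
  have h3 : t ^+ B2 * (t * C) <= t ^+ B2 * C by rewrite ler_pM2l.
  have h4 : t ^+ B2 * (2 * C) <= t ^+ B1 * t * (2 * C).
    by rewrite ler_wpM2r // mulr_ge0.
  have h5 : t ^+ B1 * (t * (2 * C)) <= t ^+ B1 * eta by rewrite ler_pM2l // ltW.
  lra.
have h1 : 0 <= t ^+ B1 * F.[Y] by rewrite mulr_ge0 // ltW.
have h2 : t ^+ B2 * eta <= t ^+ B2 * G.[Y] by rewrite ler_pM2l.
have h3 : t ^+ B2 * (t * (2 * C)) <= t ^+ B2 * eta by rewrite ler_pM2l // ltW.
have h4 : 0 <= t ^+ B2 * (t * C) by rewrite !mulr_ge0 // ltW.
lra.
Qed.

(* Logarithms turn the dominating monomial into a minimiser of a linear form
   with positive real coefficients, which is then rounded to an integer one. *)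
Lemma dominating_monomial_weight (a b K : R) (v : nat * nat) :
  0 < a < 1 -> 0 < b < 1 -> 1 < K -> v \in supp n c ->
  (forall k, k \in supp n c -> k != v ->
    K * (a ^+ k.1 * b ^+ k.2) <= a ^+ v.1 * b ^+ v.2) ->
  exists A : nat * nat, [/\ (0 < A.1)%N, (0 < A.2)%N &
    forall k, k \in supp n c -> k != v -> (weight A v < weight A k)%N].
Proof.
move=> a01 b01 K1 vs dom; have [a0 _] := andP a01; have [b0 _] := andP b01.
have K0 : 0 < K := lt_trans ltr01 K1.
pose s := - ln a; pose t := - ln b.
have s0 : 0 < s by rewrite oppr_gt0 ln_lt0.
have t0 : 0 < t by rewrite oppr_gt0 ln_lt0.
have lnK0 : 0 < ln K by rewrite ln_gt0.
(* Rounding [N * s] and [N * t] up costs at most 1 each, hence at most [v.1 + v.2 <= 2n] in the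
   weight of [v]; the gap [N * ln K] exceeds this. *)
pose N := (Num.trunc (n.*2%:R / ln K)).+1.
have NK : n.*2%:R < N%:R * ln K.
  rewrite -ltr_pdivrMr //.
  by have /andP[] := @truncn_itv R (n.*2%:R / ln K) (divr_ge0 (ler0n _ _) (ltW lnK0)).
have round (r : R) : 0 < r ->
    exists2 m : nat, (0 < m)%N & N%:R * r < m%:R <= N%:R * r + 1.
  move=> r0; have Nr : 0 <= N%:R * r by rewrite mulr_ge0 // ltW.
  exists (Num.trunc (N%:R * r)).+1 => //.
  by have /andP[h1 ->] := truncn_itv Nr; rewrite /= -natr1 lerD2r.
have [p p0 /andP[s1 s2]] := round s s0; have [q q0 /andP[t1 t2]] := round t t0.
exists (p, q); split=> // k ks kv.
have : ln K + (v.1%:R * s + v.2%:R * t) <= k.1%:R * s + k.2%:R * t.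
  have mono (m : nat * nat) : 0 < a ^+ m.1 * b ^+ m.2 by rewrite mulr_gt0 ?exprn_gt0.
  have lnm (m : nat * nat) : ln (a ^+ m.1 * b ^+ m.2) = - (m.1%:R * s + m.2%:R * t).
    by rewrite lnM ?posrE ?exprn_gt0 // !lnXn // -[ln a *+ _]mulr_natl -[ln b *+ _]mulr_natl /s /t; ring.
  have := dom k ks kv; rewrite -ler_ln ?posrE ?(mulr_gt0 K0) ?mono //.
  rewrite lnM ?posrE ?mono // !lnm; lra.
have := ks; rewrite mem_supp => /and3P[k1 k2 _].
have := vs; rewrite mem_supp => /and3P[v1 v2 _].
rewrite /weight /= -(ltr_nat R) !natrD !natrM => lnkv.
have h : N%:R * (ln K + (v.1%:R * s + v.2%:R * t)) <= N%:R * (k.1%:R * s + k.2%:R * t).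
  by rewrite ler_wpM2l.
have v1' : v.1%:R <= n%:R :> R by rewrite ler_nat.
have v2' : v.2%:R <= n%:R :> R by rewrite ler_nat.
have n2 : n.*2%:R = n%:R + n%:R :> R by rewrite -addnn natrD.
have hv1 : p%:R * v.1%:R <= (N%:R * s + 1) * v.1%:R by rewrite ler_wpM2r.
have hv2 : q%:R * v.2%:R <= (N%:R * t + 1) * v.2%:R by rewrite ler_wpM2r.
have hk1 : N%:R * s * k.1%:R <= p%:R * k.1%:R by rewrite ler_wpM2r // ltW.
have hk2 : N%:R * t * k.2%:R <= q%:R * k.2%:R by rewrite ler_wpM2r // ltW.
lra.
Qed.

(** The term at [v] is nonnegative, being a main form. Every other monomial is at most [M / K], with
    [M] the one at [v], so by the bound on the coefficients the remaining terms sum to at most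
    [|c v.1 v.2| * M]. *)
Lemma dominating_monomial_ge0 (a b K sigma tau : R) (v : nat * nat) :
  `|sigma| = 1 -> `|tau| = 1 ->
  0 < a < 1 -> 0 < b < 1 -> 1 < K -> v \in supp n c ->
  \sum_(i < n.+1) \sum_(j < n.+1) `|c i j| <= K * `|c v.1 v.2| ->
  (forall k, k \in supp n c -> k != v ->
    K * (a ^+ k.1 * b ^+ k.2) <= a ^+ v.1 * b ^+ v.2) ->
  0 <= peval n c (sigma * a) (tau * b).
Proof.
move=> sigma1 tau1 a01 b01 K1 vs SK dom.
have [A [A1 A2 vmin]] := dominating_monomial_weight a01 b01 K1 vs dom.
have vpos := vertex_monomial_ge0 hnn A1 A2 vs vmin (sigma * a) (tau * b).
have [a0 _] := andP a01; have [b0 _] := andP b01.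
have K0 : 0 < K := lt_trans ltr01 K1.
have normm (r : R) i j :
    `|r * (sigma * a) ^+ i * (tau * b) ^+ j| = `|r| * (a ^+ i * b ^+ j).
  rewrite !normrM !normrX !normrM sigma1 tau1 !mul1r.
  by rewrite (gtr0_norm a0) (gtr0_norm b0) mulrA.
have := vs; rewrite mem_supp => /and3P[v1 v2 _].
pose rest i j := if (i, j) == v then 0 else c i j.
have -> : peval n c (sigma * a) (tau * b) =
    c v.1 v.2 * (sigma * a) ^+ v.1 * (tau * b) ^+ v.2
    + peval n rest (sigma * a) (tau * b).
  rewrite -(peval_monomial _ _ _ v1 v2) -pevalD; apply: eq_peval => i j _ _.
  by rewrite /rest; case: eqP => [<-|_]; rewrite ?addr0 ?add0r.
pose M := a ^+ v.1 * b ^+ v.2.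
have M0 : 0 < M by rewrite mulr_gt0 ?exprn_gt0.
have restM : `|peval n rest (sigma * a) (tau * b)| <=
    \sum_(i < n.+1) \sum_(j < n.+1) `|c i j| * (M / K).
  apply: (peval_bound (b := fun i j => `|c i j| * (M / K))) => i j i_n j_n; rewrite normm /rest.
  have MK : 0 <= M / K by rewrite ltW // divr_gt0.
  case: eqP => [_|/eqP ijv]; first by rewrite normr0 mul0r mulr_ge0.
  have [->|cij] := eqVneq (c i j) 0; first by rewrite normr0 !mul0r.
  rewrite ler_wpM2l // ler_pdivlMr // mulrC.
  by apply: (dom (i, j)) => //; rewrite mem_supp /= i_n j_n.
have restK : `|peval n rest (sigma * a) (tau * b)| <= `|c v.1 v.2| * M.
  apply: le_trans restM _; under eq_bigr do rewrite -mulr_suml.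
  rewrite -mulr_suml mulrA ler_pdivrMr // mulrAC.
  by rewrite ler_wpM2r ?(ltW M0) // [leRHS]mulrC.
rewrite -[X in X + _]ger0_norm // normm -/M.
by move: restK; rewrite ler_norml => /andP[]; lra.
Qed.

(* Meant for [k] on the upper left of [l]; otherwise the truncated subtractions
   make a component vanish. *)
Definition edge_normal (k l : nat * nat) : nat * nat :=
  let g := gcdn (k.2 - l.2) (l.1 - k.1) in
  ((k.2 - l.2) %/ g, (l.1 - k.1) %/ g)%N.

(** Passing from [k] to [l] brings in at least one factor [a] or [b], each below [1/K]; further
    factors are at most 1. *)
Lemma comparable_monomial_gap (a b K : R) (k l : nat * nat) :
  0 < a -> 0 < b -> 1 < K -> K * a < 1 -> K * b < 1 ->
  (k.1 <= l.1)%N -> (k.2 <= l.2)%N -> k != l ->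
  K * (a ^+ l.1 * b ^+ l.2) < a ^+ k.1 * b ^+ k.2.
Proof.
move=> a0 b0 K1 Ka Kb kl1 kl2 kl; have K0 : 0 < K := lt_trans ltr01 K1.
have a1 : a <= 1 by apply: ltW; apply: le_lt_trans Ka; rewrite ler_peMl // ltW.
have b1 : b <= 1 by apply: ltW; apply: le_lt_trans Kb; rewrite ler_peMl // ltW.
have pos (i j : nat) : 0 < a ^+ i * b ^+ j by rewrite mulr_gt0 ?exprn_gt0.
have [l1|l1] := ltnP k.1 l.1.
  apply: (@le_lt_trans _ _ (K * a * (a ^+ k.1 * b ^+ k.2))); last first.
    by rewrite gtr_pMl.
  rewrite -mulrA ler_pM2l // mulrA -exprS ler_pM ?exprn_ge0 ?(ltW a0) ?(ltW b0) //.
    by rewrite ler_wiXn2l // ltW.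
  by rewrite ler_wiXn2l // ltW.
have e1 : k.1 = l.1 by lia.
have l2 : (k.2 < l.2)%N.
  rewrite ltn_neqAle kl2 andbT; apply: contraNneq kl => e2.
  by rewrite [k]surjective_pairing [l]surjective_pairing e1 e2.
apply: (@le_lt_trans _ _ (K * b * (a ^+ k.1 * b ^+ k.2))); last first.
  by rewrite gtr_pMl.
rewrite -mulrA ler_pM2l // mulrCA -exprS -e1 ler_wpM2l ?exprn_ge0 ?(ltW a0) //.
by rewrite ler_wiXn2l // ltW.
Qed.

(** Up to the common factor [a ^+ k.1 * b ^+ l.2], the two monomials are the [g]-th powers of
    [b ^+ A.1] and [a ^+ A.2]; a ratio beyond [K > 1] stays beyond [K] under a positive power. *)
Lemma antichain_monomial_gap (a b K : R) (k l : nat * nat) :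
  0 < a -> 0 < b -> 1 < K -> (k.1 < l.1)%N -> (l.2 < k.2)%N ->
  let A := edge_normal k l in
  [/\ (0 < A.1)%N, (0 < A.2)%N & coprime A.1 A.2] /\
  (K * b ^+ A.1 < a ^+ A.2 ->
     K * (a ^+ k.1 * b ^+ k.2) < a ^+ l.1 * b ^+ l.2) /\
  (K * a ^+ A.2 < b ^+ A.1 ->
     K * (a ^+ l.1 * b ^+ l.2) < a ^+ k.1 * b ^+ k.2).
Proof.
move=> a0 b0 K1 kl1 kl2; rewrite /edge_normal.
set f := (k.2 - l.2)%N; set d := (l.1 - k.1)%N; set g := gcdn f d.
have K0 : 0 < K := lt_trans ltr01 K1.
have f0 : (0 < f)%N by rewrite subn_gt0.
have d0 : (0 < d)%N by rewrite subn_gt0.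
have g0 : (0 < g)%N by rewrite gcdn_gt0 f0.
have fE : f = (f %/ g * g)%N by rewrite divnK ?dvdn_gcdl.
have dE : d = (d %/ g * g)%N by rewrite divnK ?dvdn_gcdr.
have f'0 : (0 < f %/ g)%N by rewrite divn_gt0 // dvdn_leq // dvdn_gcdl.
have d'0 : (0 < d %/ g)%N by rewrite divn_gt0 // dvdn_leq // dvdn_gcdr.
have cop : coprime (f %/ g)%N (d %/ g)%N.
  have := muln_gcdl (f %/ g)%N (d %/ g)%N g; rewrite -fE -dE -/g => /eqP.
  by rewrite -[X in _ == X]mul1n eqn_pmul2r.
have pow (x y : R) : 0 < x -> 0 < y -> K * x < y -> K * x ^+ g < y ^+ g.
  move=> x0 y0 xy; apply: le_lt_trans (_ : (K * x) ^+ g < _); last first.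
    by rewrite ltr_pXn2r ?nnegrE ?mulr_ge0 // ltW.
  by rewrite exprMn ler_wpM2r ?exprn_ge0 ?(ltW x0) // ler_eXnr // ltW.
have mk : a ^+ k.1 * b ^+ k.2 = a ^+ k.1 * b ^+ l.2 * (b ^+ (f %/ g)%N) ^+ g.
  by rewrite -exprM -fE -mulrA -exprD subnKC // ltnW.
have ml : a ^+ l.1 * b ^+ l.2 = a ^+ k.1 * b ^+ l.2 * (a ^+ (d %/ g)%N) ^+ g.
  by rewrite -exprM -dE mulrAC -exprD subnKC // ltnW.
have q0 : 0 < a ^+ k.1 * b ^+ l.2 by rewrite mulr_gt0 ?exprn_gt0.
split=> //=; rewrite mk ml !(mulrCA K) !ltr_pM2l //.
by split; apply: pow; rewrite exprn_gt0.
Qed.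

(** * From the two regimes to a full neighbourhood of the origin *)

Lemma quadrant_ge0 (sigma tau : R) : `|sigma| = 1 -> `|tau| = 1 ->
  (forall A, inAp n c A -> C2 n c A) ->
  exists2 e, 0 < e & forall a b : R, 0 < a < e -> 0 < b < e ->
    0 <= peval n c (sigma * a) (tau * b).
Proof.
move=> sigma1 tau1 hC2.
pose S := \sum_(i < n.+1) \sum_(j < n.+1) `|c i j|.
have S0 : 0 <= S by apply: sumr_ge0 => i _; apply: sumr_ge0.
(* The summand [S / |c i j|] makes [K] large enough whichever monomial dominates; zero coefficients
   contribute 0, as division by 0 yields 0. *)
pose K := 2 + \sum_(i < n.+1) \sum_(j < n.+1) S / `|c i j|.
have Sc0 (i j : nat) : 0 <= S / `|c i j| by rewrite divr_ge0.
have K1 : 1 < K.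
  by rewrite /K ltr_wpDr ?ltr1n //; apply: sumr_ge0 => i _; apply: sumr_ge0.
have K0 : 0 < K := lt_trans ltr01 K1.
have SK v : v \in supp n c -> S <= K * `|c v.1 v.2|.
  rewrite mem_supp => /and3P[v1 v2 cv].
  rewrite -ler_pdivrMr ?normr_gt0 // /K ler_wpDl //.
  rewrite -ltnS in v1; rewrite -ltnS in v2.
  rewrite (bigD1 (Ordinal v1)) //= (bigD1 (Ordinal v2)) //= -addrA lerDl.
  by apply: addr_ge0; apply: sumr_ge0 => // i _; apply: sumr_ge0.
(* The guard is there because [L] runs over all pairs of support points, including those with a
   degenerate [edge_normal]. *)
pose P (A : nat * nat) e := [&& 0 < A.1, 0 < A.2 & coprime A.1 A.2]%N ->
  forall a b : R, 0 < a < e -> 0 < b ->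
    a ^+ A.2 <= K * b ^+ A.1 -> b ^+ A.1 <= K * a ^+ A.2 ->
    0 <= peval n c (sigma * a) (tau * b).
pose L := [seq edge_normal k l | k <- supp n c, l <- supp n c].
have [|A AL|e e0 Pe] := @uniform_radius R _ L P.
- move=> A d e de Pe okA a b /andP[a0 ad]; apply: (Pe okA).
  by rewrite a0 (lt_le_trans ad).
- have [/and3P[A1 A2 cA]|nokA] := boolP [&& 0 < A.1, 0 < A.2 & coprime A.1 A.2]%N.
    have [e e0 he] := edge_region_ge0 sigma1 tau1 (ltW K1) A1 A2 cA (hC2 A).
    by exists e => // _; exact: he.
  by exists 1 => // okA; rewrite okA in nokA.
exists (Num.min e K^-1) => [|a b]; first by rewrite lt_min e0 invr_gt0.
rewrite !lt_min => /and3P[a0 ae aK] /and3P[b0 be bK].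
have Ka : K * a < 1 by rewrite -ltr_pdivlMl // mulr1.
have Kb : K * b < 1 by rewrite -ltr_pdivlMl // mulr1.
(* A negative value keeps [(a, b)] out of every edge region, so any two monomials differ by a factor
   above [K] and the largest one dominates. *)
rewrite leNgt; apply/negP => pneg.
pose m (k : nat * nat) := a ^+ k.1 * b ^+ k.2.
have anti k l : k \in supp n c -> l \in supp n c ->
    (k.1 < l.1)%N -> (l.2 < k.2)%N -> K * m k < m l \/ K * m l < m k.
  move=> ks ls kl1 kl2.
  have [[A1 A2 cA] [far1 far2]] := antichain_monomial_gap a0 b0 K1 kl1 kl2.
  have AL : edge_normal k l \in L by apply/allpairsP; exists (k, l).
  have := Pe _ AL; rewrite /P A1 A2 cA => /(_ isT a b).
  rewrite a0 ae => /(_ isT b0) near.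
  have [n1|/far1] := lerP (a ^+ (edge_normal k l).2) (K * b ^+ (edge_normal k l).1);
    last by left.
  have [n2|/far2] := lerP (b ^+ (edge_normal k l).1) (K * a ^+ (edge_normal k l).2);
    last by right.
  by move: (near n1 n2); rewrite leNgt pneg.
have gap k l : k \in supp n c -> l \in supp n c -> k != l ->
    K * m k < m l \/ K * m l < m k.
  move=> ks ls kl; have [kl1|lk1] := leqP k.1 l.1; have [kl2|lk2] := leqP k.2 l.2.
  - by right; apply: comparable_monomial_gap.
  - have [kl1'|lk1] := ltnP k.1 l.1; first exact: anti.
    by left; apply: comparable_monomial_gap; rewrite // 1?eq_sym // ltnW.
  - have [kl2'|lk2] := ltnP k.2 l.2; first by case: (anti l k) => //; [right|left].
    by left; apply: comparable_monomial_gap; rewrite // 1?eq_sym // ltnW.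
  - by left; apply: comparable_monomial_gap; rewrite // 1?eq_sym // ltnW.
have [v vs vmax] := seq_extremum m (@ge_total _ R) ge_trans supp0.
suff : 0 <= peval n c (sigma * a) (tau * b) by rewrite leNgt pneg.
have K1' : K^-1 <= 1 by rewrite invf_le1 // ltW.
apply: (dominating_monomial_ge0 (K := K) (v := v)) => //.
- by rewrite a0 (lt_le_trans aK).
- by rewrite b0 (lt_le_trans bK).
- exact: SK.
move=> k ks kv; have [/ltW//|] := gap _ _ ks vs kv.
move=> vk; have /= := vmax k ks; rewrite leNgt (le_lt_trans _ vk) //.
by rewrite ler_peMl // ltW // mulr_gt0 ?exprn_gt0.
Qed.

(** The four open quadrants share a radius. A limit in [x] adds the points with [x = 0] and
    [y != 0], then a limit in [y] adds the whole axis [y = 0]. *)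
Lemma locmin_of_C2 : (forall A, inAp n c A -> C2 n c A) -> locmin n c.
Proof.
move=> hC2; pose P (z : R * R) e := forall a b : R, 0 < a < e -> 0 < b < e ->
    0 <= peval n c (z.1 * a) (z.2 * b).
have [|z zs|e e0 Pe] := @uniform_radius R _ [seq (s, t) | s <- [:: 1; -1], t <- [:: 1; -1]] P.
- move=> z d e de Pe a b /andP[a0 ad] /andP[b0 bd].
  by apply: Pe; rewrite ?a0 ?b0 (lt_le_trans _ de).
- have norm1 (s : R) : s \in [:: 1; -1] -> `|s| = 1.
    by rewrite !inE => /orP[] /eqP ->; rewrite ?normrN normr1.
  have /allpairsP[[s t] /= [ss ts ->]] := zs.
  exact: quadrant_ge0 (norm1 _ ss) (norm1 _ ts) hC2.
have sgs (x : R) : x != 0 -> Num.sg x \in [:: 1; -1].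
  by rewrite !inE; case: sgrP; rewrite ?eqxx ?orbT.
have off x y : x != 0 -> y != 0 -> `|x| < e -> `|y| < e -> 0 <= peval n c x y.
  move=> x0 y0 xe ye; rewrite [x]numEsg [y]numEsg.
  apply: (Pe (Num.sg x, Num.sg y)); rewrite ?normr_gt0 ?x0 ?y0 //.
  by apply/allpairsP; exists (Num.sg x, Num.sg y); split=> //; apply: sgs.
exists e => // x y xe ye; rewrite peval0 c00.
have offy x' y' : y' != 0 -> `|x'| < e -> `|y'| < e -> 0 <= peval n c x' y'.
  have [-> y0 _ ye'|x0] := eqVneq x' 0; last exact: off.
  have [q qE] := peval_poly_l n c y'; rewrite -qE.
  by apply: (poly_ge0_limit e0) => s s0; rewrite subr0 qE => se; apply: off.
have [->|y0] := eqVneq y 0; last exact: offy.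
have [q qE] := peval_poly n c x 1; have := qE 0; rewrite mulr0 => <-.
by apply: (poly_ge0_limit e0) => s s0; rewrite subr0 qE mul1r => se; apply: offy.
Qed.

Lemma not_locmin_of_C1 (A : nat * nat) : (0 < A.1)%N -> (0 < A.2)%N ->
  C1 n c A -> ~ locmin n c.
Proof.
move=> A1 A2 [x0 [y0 [phi0 phi1]]] [e e0 min].
have [B1 [B2 [B12 p0 p1 lev]]] := two_levels c00 A1 A2 supp0.
pose C := \sum_(i < n.+1) \sum_(j < n.+1) `|c i j| * `|x0| ^+ i * `|y0| ^+ j.
have C0 : 0 <= C.
  apply: sumr_ge0 => i _; apply: sumr_ge0 => j _.
  by rewrite !mulr_ge0 ?exprn_ge0.
(* One bound on [t] times this sum ensures both that the remainder stays below [- v] and that the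
   point of the curve stays within [e]. *)
have M0 : 0 <= C + `|x0| + `|y0| by rewrite !addr_ge0.
set v := peval n (phi n c A 1) x0 y0 in phi1.
have m0 : 0 < Num.min (- v) e by rewrite lt_min oppr_gt0 phi1.
have [t [t0 t1]] := small_scale M0 m0; rewrite lt_min => /andP[tv te].
have tx : t * `|x0| <= t * (C + `|x0| + `|y0|).
  by rewrite ler_pM2l //; have := normr_ge0 y0; lra.
have ty : t * `|y0| <= t * (C + `|x0| + `|y0|).
  by rewrite ler_pM2l //; have := normr_ge0 x0; lra.
have tC : t * C <= t * (C + `|x0| + `|y0|).
  by rewrite ler_pM2l //; have := normr_ge0 x0; have := normr_ge0 y0; lra.
have small (z : R) m : (0 < m)%N -> t * `|z| < e -> `|t ^+ m * z| < e.
  move=> m1; apply: le_lt_trans; rewrite normrM normrX (gtr0_norm t0).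
  by rewrite ler_wpM2r // ler_iXnr // ltW.
have := min (t ^+ A.1 * x0) (t ^+ A.2 * y0).
rewrite peval0 c00 leNgt => /(_ (small _ _ A1 (le_lt_trans tx te))).
move=> /(_ (small _ _ A2 (le_lt_trans ty te))) /negP; apply.
have := @quasi_homogeneous_expansion _ _ _ _ _ _ t x0 y0 B12 p0 p1 lev.
rewrite ltW // t1 phi0 mulr0 add0r -/v -/C => /(_ isT).
rewrite ler_norml => /andP[_]; rewrite exprS => pC.
have tB : 0 < t ^+ B2 by rewrite exprn_gt0.
have : t ^+ B2 * (t * C) < t ^+ B2 * - v by rewrite ltr_pM2l // (le_lt_trans tC).
lra.
Qed.

End Positivity.

Theorem theorem3 (R : realType) (n : nat) (c : nat -> nat -> R)
  (hc : forall i j : nat, (n < i)%N \/ (n < j)%N -> c i j = 0)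
  (h0 : peval n c 0 0 = 0)
  (hgrad : peval n (dx c) 0 0 = 0 /\ peval n (dy c) 0 0 = 0)
  (hdim : dimCo2 n c)
  (hnn : forall A : nat * nat, (0 < A.1)%N -> (0 < A.2)%N ->
           forall x y : R, 0 <= peval n (phi n c A 0) x y) :
  ((forall A : nat * nat, ~ inAp n c A) -> locmin n c) /\
  ((exists A : nat * nat, inAp n c A /\ C1 n c A) -> ~ locmin n c) /\
  ((exists A : nat * nat, inAp n c A) ->
     (forall A : nat * nat, inAp n c A -> ~ C1 n c A /\ C2 n c A) ->
     locmin n c).
Proof.
have c00 : c 0%N 0%N = 0 by rewrite -(peval0 n).
have supp0 : supp n c != [::].
  by case: hdim => k [_ [_ [+ _ _ _]]]; case: (supp n c).
(* In (i) the implication from [inAp] to [C2] holds vacuously; in (iii) it is assumed. *)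
split=> [noA|]; first by apply: locmin_of_C2 => // A /noA.
split=> [[A [[[A1 A2 _] _] hC1]]|_ hA].
  exact: not_locmin_of_C1 hC1.
by apply: locmin_of_C2 => // A /hA[].
Qed.
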